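(* Let $(M,J,g)$ be a $(J^2=\pm1)$-metric manifold, i.e. a manifold with an $(\alpha,\varepsilon)$-structure $(J,g)$, $\alpha,\varepsilon\in\{-1,1\}$. Let $\mathrm{T}^0$ be the torsion tensor of its first canonical connection $\nabla^0$. Then: (i) The manifold $(M,J,g)$ is a Kähler type manifold if and only if $\mathrm{T}^0=0$. (ii) The manifold $(M,J,g)$ is an integrable manifold if and only if $$\mathrm{T}^{0}(JX,JY)+\alpha\,\mathrm{T}^{0}(X,Y)=0,\quad \forall X,Y\in\mathfrak{X}(M).$$
   Context: $M$ is a smooth manifold, $\mathfrak{X}(M)$ is the set of vector fields on $M$, and $Id$ is the identity tensor field. For $\alpha,\varepsilon\in\{-1,1\}$, an $(\alpha,\varepsilon)$-structure on $M$ is a pair $(J,g)$ of a $(1,1)$-tensor field $J$ and a semi-Riemannian metric $g$ with $J^2=\alpha Id$ and $g(JX,JY)=\varepsilon g(X,Y)$ for all $X,Y\in\mathfrak{X}(M)$; then $(M,J,g)$ is called a $(J^2=\pm1)$-metric manifold. If $\varepsilon=1$, $g$ is Riemannian; if $\varepsilon=-1$, $g$ has signature $(n,n)$ with $\dim M=2n$; if $\alpha=\varepsilon=1$, the trace of $J$ is assumed to vanish (so $\dim M$ is even). $\nabla^{\mathrm g}$ denotes the Levi Civita connection of $g$. $(M,J,g)$ is a Kähler type manifold if $\nabla^{\mathrm g}J=0$, and is integrable if the Nijenhuis tensor of $J$, $N_J(X,Y)=J^2[X,Y]+[JX,JY]-J[JX,Y]-J[X,JY]$, vanishes. The first canonical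 connection of $(M,J,g)$ is $$\nabla^0_XY=\nabla^{\mathrm g}_XY+\frac{(-\alpha)}{2}(\nabla^{\mathrm g}_XJ)JY,\quad X,Y\in\mathfrak{X}(M),$$ and its torsion tensor is $\mathrm{T}^0(X,Y)=\nabla^0_XY-\nabla^0_YX-[X,Y]$. *)

(* Defs.v *)
From HB Require Import structures.
From mathcomp Require Import all_boot all_order all_algebra.
From mathcomp Require Import all_classical reals topology normedtype derive.
From mathcomp Require Import ring.

Set Implicit Arguments.
Unset Strict Implicit.
Unset Printing Implicit Defensive.

Import Order.TTheory GRing.Theory Num.Theory.
Import numFieldNormedType.Exports.
Local Open Scope classical_set_scope.
Local Open Scope ring_scope.

(* [Ck k U f]: on the open set [U] of R^m, [f] has continuous partial
   derivatives of all orders at most [k].  [f] is a total function, but only its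
   values on [U] matter. *)
Fixpoint Ck (R : realType) (m k : nat) (U : set 'rV[R]_m)
    (f : 'rV[R]_m -> R) : Prop :=
  (forall x, U x -> {for x, continuous f}) /\
  if k is k'.+1 then
    forall i : 'I_m, (forall x, U x -> derivable f x (delta_mx 0 i)) /\
                     Ck k' U ('D_(delta_mx 0 i) f)
  else True.

Section CkTheory.
Variables (R : realType) (m : nat) (U : set 'rV[R]_m).
Hypothesis openU : open U.
Implicit Types f g : 'rV[R]_m -> R.

Lemma near_eq_on f g x :
  (forall y, U y -> f y = g y) -> U x -> {near x, f =1 g}.
Proof.
move=> fg Ux; have : nbhs x U by exact: open_nbhs_nbhs.
by apply: filterS => y Uy; exact: fg.
Qed.

Lemma Ck_eq k f g : (forall x, U x -> f x = g x) -> Ck k U f -> Ck k U g.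
Proof.
have ctsW (h l : 'rV[R]_m -> R) : (forall x, U x -> h x = l x) ->
    (forall x, U x -> {for x, continuous h}) ->
    forall x, U x -> {for x, continuous l}.
  move=> hl ch x Ux; rewrite /prop_for /continuous_at -(hl x Ux).
  exact: cvg_trans (near_eq_cvg (near_eq_on hl Ux)) (ch x Ux).
elim: k f g => [|k IHk] f g fg [cf df]; split=> //; try exact: (ctsW _ _ fg cf).
move=> i; have [dfi Cfi] := df i; split=> [x Ux|].
  by apply: near_eq_derivable (dfi x Ux); exact: near_eq_on Ux.
by apply: IHk Cfi => x Ux; apply: near_eq_derive; exact: near_eq_on Ux.
Qed.

Lemma CkW k f : Ck k.+1 U f -> Ck k U f.
Proof.
elim: k f => [|k IHk] f [cf df]; first by split.
by split=> // i; have [dfi Cfi] := df i; split=> //; exact: IHk.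
Qed.

Lemma Ck_cst k (a : R) : Ck k U (cst a).
Proof.
elim: k a => [|k IHk] a; split=> //; try (by move=> x _; exact: cst_continuous).
move=> i; split=> [x _|]; first exact: derivable_cst.
by apply: (Ck_eq (f := cst 0) _ (IHk 0)) => x _; rewrite derive_cst.
Qed.

Lemma CkD k f g : Ck k U f -> Ck k U g -> Ck k U (f + g).
Proof.
elim: k f g => [|k IHk] f g [cf df] [cg dg]; split=> //;
  try (by move=> x Ux; apply: continuousD; [exact: cf|exact: cg]).
move=> i; have [dfi Cfi] := df i; have [dgi Cgi] := dg i.
split=> [x Ux|]; first by apply: derivableD; [exact: dfi|exact: dgi].
apply: Ck_eq (IHk _ _ Cfi Cgi) => x Ux.
by rewrite deriveD; [|exact: dfi|exact: dgi].
Qed.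

Lemma CkM k f g : Ck k U f -> Ck k U g -> Ck k U (f * g).
Proof.
elim: k f g => [|k IHk] f g Cf Cg;
  have [cf df] := Cf; have [cg dg] := Cg; split=> //;
  try (by move=> x Ux; apply: continuousM; [exact: cf|exact: cg]).
move=> i; have [dfi Cfi] := df i; have [dgi Cgi] := dg i.
split=> [x Ux|]; first by apply: derivableM; [exact: dfi|exact: dgi].
apply: Ck_eq (CkD (IHk _ _ (CkW Cf) Cgi) (IHk _ _ (CkW Cg) Cfi)) => x Ux.
by rewrite deriveM; [|exact: dfi|exact: dgi].
Qed.

Lemma CkN k f : Ck k U f -> Ck k U (- f).
Proof.
move=> Cf; apply: Ck_eq (CkM (Ck_cst k (-1)) Cf) => x _ /=.
by rewrite /cst [LHS]/GRing.mul/= mulN1r.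
Qed.

End CkTheory.

Section Manifolds.
Variables (R : realType) (m : nat).

(* The two maps are total functions; they are only meaningful on [chart_dom] and
   [chart_cod] respectively. *)
Record chart (T : topologicalType) := Chart {
  chart_dom : set T;
  chart_cod : set 'rV[R]_m;
  chart_fun : T -> 'rV[R]_m;
  chart_inv : 'rV[R]_m -> T;
  chart_dom_open : open chart_dom;
  chart_cod_open : open chart_cod;
  chart_funP : forall x, chart_dom x -> chart_cod (chart_fun x);
  chart_invP : forall y, chart_cod y -> chart_dom (chart_inv y);
  chart_funK : forall x, chart_dom x -> chart_inv (chart_fun x) = x;
  chart_invK : forall y, chart_cod y -> chart_fun (chart_inv y) = y;
  chart_fun_continuous :
    forall x, chart_dom x -> {for x, continuous chart_fun};
  chart_inv_continuous :
    forall y, chart_cod y -> {for y, continuous chart_inv} }.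

Definition smooth_transition (T : topologicalType) (c d : chart T) :=
  forall (k : nat) (i : 'I_m),
    Ck k (chart_cod c `&` chart_inv c @^-1` chart_dom d)
      (fun y => chart_fun d (chart_inv c y) 0 i).

Record manifold := Manifold {
  carrier :> topologicalType;
  atlas : set (chart carrier);
  manifold_hausdorff : hausdorff_space carrier;
  manifold_second_countable : @second_countable carrier;
  atlas_cover : forall x : carrier, exists2 c, atlas c & chart_dom c x;
  atlas_compatible :
    forall c d, atlas c -> atlas d -> smooth_transition c d }.

End Manifolds.

Section SmoothFunctions.
Variables (R : realType) (m : nat) (M : manifold R m).

Definition smooth (f : M -> R) : Prop :=
  forall c, atlas c -> forall k, Ck k (chart_cod c) (f \o chart_inv c).

Definition smooth_pred : {pred M -> R} := [pred f | `[< smooth f >]].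

Record smooth_fun := SmoothFun {
  smooth_val :> M -> R;
  smooth_valP : smooth_val \in smooth_pred }.

HB.instance Definition _ := [isSub for smooth_val].
HB.instance Definition _ := [Choice of smooth_fun by <:].

Lemma smooth_cst a : smooth (cst a).
Proof. by move=> c _ k; exact/Ck_cst/chart_cod_open. Qed.

Lemma smoothD f g : smooth f -> smooth g -> smooth (f + g).
Proof.
by move=> sf sg c ac k; apply: CkD (sf c ac k) (sg c ac k); exact: chart_cod_open.
Qed.

Lemma smoothN f : smooth f -> smooth (- f).
Proof. by move=> sf c ac k; apply: CkN (sf c ac k); exact: chart_cod_open. Qed.

Lemma smoothM f g : smooth f -> smooth g -> smooth (f * g).
Proof.
by move=> sf sg c ac k; apply: CkM (sf c ac k) (sg c ac k); exact: chart_cod_open.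
Qed.

Fact smooth_subring : subring_closed smooth_pred.
Proof.
split.
- by apply/asboolP; exact: (smooth_cst 1).
- by move=> f g /asboolP sf /asboolP sg; apply/asboolP/smoothD/smoothN.
- by move=> f g /asboolP sf /asboolP sg; apply/asboolP/smoothM.
Qed.

HB.instance Definition _ :=
  GRing.SubChoice_isSubComPzRing.Build _ smooth_pred smooth_fun smooth_subring.

Lemma smooth_funP (f : smooth_fun) : smooth f.
Proof. exact/asboolP/smooth_valP. Qed.

Definition mk_smooth (f : M -> R) (sf : smooth f) : smooth_fun :=
  SmoothFun (introT (asboolP (smooth f)) sf).

(* The constant function a, so that [csmooth a *: X] is the real multiple a X. *)
Definition csmooth (a : R) : smooth_fun := mk_smooth (smooth_cst a).

Lemma smooth_fun_ext (f g : smooth_fun) : (forall p, f p = g p) -> f = g.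
Proof. by move=> fg; apply: val_inj; exact/funext. Qed.

End SmoothFunctions.

Section TangentVectors.
Variables (R : realType) (m : nat) (M : manifold R m).
Local Notation Cinf := (smooth_fun M).

(* Tangent vectors at [p] are the R-linear maps C^oo(M) -> R satisfying the
   Leibniz rule at [p]. *)
Definition is_tangent (p : M) (v : Cinf -> R) : Prop :=
  (forall a f g, v (csmooth M a * f + g) = a * v f + v g) /\
  (forall f g, v (f * g) = v f * g p + f p * v g).

Definition tangent_pred (p : M) : {pred Cinf -> R} :=
  [pred v | `[< is_tangent p v >]].

Record tangent (p : M) := Tangent {
  tangent_val :> Cinf -> R;
  tangent_valP : tangent_val \in tangent_pred p }.

HB.instance Definition _ p := [isSub for @tangent_val p].
HB.instance Definition _ p := [Choice of tangent p by <:].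

Fact tangent_submod p : subsemimod_closed (tangent_pred p).
Proof.
split; first split.
- apply/asboolP; split=> [a f g|f g] /=.
    by rewrite /GRing.zero/= mulr0 addr0.
  by rewrite /GRing.zero/= mul0r mulr0 addr0.
- move=> v w /asboolP[vl vm] /asboolP[wl wm]; apply/asboolP.
  split=> [a f g|f g].
    have -> h : (v + w) h = v h + w h by [].
    by rewrite vl wl mulrDr addrACA.
  have -> h : (v + w) h = v h + w h by [].
  by rewrite vm wm mulrDl mulrDr addrACA.
- move=> b v /asboolP[vl vm]; apply/asboolP.
  split=> [a f g|f g].
    have -> h : (b *: v) h = b * v h by [].
    by rewrite vl mulrDr mulrCA.
  have -> h : (b *: v) h = b * v h by [].
  by rewrite vm mulrDr mulrA mulrCA.
Qed.

HB.instance Definition _ p :=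
  GRing.SubChoice_isSubLmodule.Build _ _ (tangent_pred p) (tangent p)
    (tangent_submod p).

End TangentVectors.

Section VectorFields.
Variables (R : realType) (m : nat) (M : manifold R m).
Local Notation Cinf := (smooth_fun M).

(* A vector field acts on C^oo(M) by (X f)(p) = X p f; smoothness means that
   X f is smooth for every smooth f. *)
Record vector_field := VectorField {
  vf_at :> forall p : M, tangent p;
  vf_smooth : forall f : Cinf, smooth (fun p => vf_at p f) }.

HB.instance Definition _ := gen_eqMixin vector_field.
HB.instance Definition _ := gen_choiceMixin vector_field.

Implicit Types (X Y Z : vector_field) (f h : Cinf).

Definition vf_app X f : Cinf := mk_smooth (vf_smooth X f).

Lemma vf_ext X Y : (forall p f, X p f = Y p f) -> X = Y.
Proof.
case: X Y => [X sX] [Y sY] /= XY.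
have eXY : X = Y.
  apply: functional_extensionality_dep => p.
  by apply: val_inj; apply/funext => f; exact: XY.
by case: Y / eXY sY {XY} => sY; congr VectorField; exact: Prop_irrelevance.
Qed.

Fact vf_zero_smooth f : smooth (fun p => (0 : tangent p) f).
Proof. exact: (@smooth_cst _ _ M 0). Qed.
Definition vf_zero := VectorField vf_zero_smooth.

Fact vf_opp_smooth X f : smooth (fun p => (- X p) f).
Proof. exact: (smoothN (vf_smooth X f)). Qed.
Definition vf_opp X := VectorField (vf_opp_smooth X).

Fact vf_add_smooth X Y f : smooth (fun p => (X p + Y p) f).
Proof. exact: (smoothD (vf_smooth X f) (vf_smooth Y f)). Qed.
Definition vf_add X Y := VectorField (vf_add_smooth X Y).

Fact vf_scale_smooth h X f : smooth (fun p => (h p *: X p) f).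
Proof. exact: (smoothM (smooth_funP h) (vf_smooth X f)). Qed.
Definition vf_scale h X := VectorField (vf_scale_smooth h X).

Fact vf_addA : associative vf_add.
Proof. by move=> X Y Z; apply: vf_ext => p f; exact: addrA. Qed.
Fact vf_addC : commutative vf_add.
Proof. by move=> X Y; apply: vf_ext => p f; exact: addrC. Qed.
Fact vf_add0 : left_id vf_zero vf_add.
Proof. by move=> X; apply: vf_ext => p f; exact: add0r. Qed.
Fact vf_addN : left_inverse vf_zero vf_opp vf_add.
Proof. by move=> X; apply: vf_ext => p f; exact: addNr. Qed.

HB.instance Definition _ :=
  GRing.isZmodule.Build vector_field vf_addA vf_addC vf_add0 vf_addN.

Fact vf_scaleA a b X : vf_scale a (vf_scale b X) = vf_scale (a * b) X.
Proof. by apply: vf_ext => p f; exact: mulrA. Qed.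
Fact vf_scale1 : left_id 1 vf_scale.
Proof. by move=> X; apply: vf_ext => p f; exact: mul1r. Qed.
Fact vf_scaleDr : right_distributive vf_scale +%R.
Proof. by move=> a X Y; apply: vf_ext => p f; exact: mulrDr. Qed.
Fact vf_scaleDl X : {morph vf_scale^~ X : a b / a + b}.
Proof. by move=> a b; apply: vf_ext => p f; exact: mulrDl. Qed.

HB.instance Definition _ :=
  GRing.Zmodule_isLmodule.Build _ vector_field
    vf_scaleA vf_scale1 vf_scaleDr vf_scaleDl.

Definition bracket_at X Y (p : M) : Cinf -> R :=
  fun f => X p (vf_app Y f) - Y p (vf_app X f).

Lemma tangentL p (v : tangent p) a f g : v (csmooth M a * f + g) = a * v f + v g.
Proof. by have /asboolP[vl _] := tangent_valP v; exact: vl. Qed.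

Lemma tangentM p (v : tangent p) f g : v (f * g) = v f * g p + f p * v g.
Proof. by have /asboolP[_ vm] := tangent_valP v; exact: vm. Qed.

Lemma tangentD p (v : tangent p) f g : v (f + g) = v f + v g.
Proof.
have := tangentL v 1 f g.
have -> : csmooth M 1 = 1 by apply: smooth_fun_ext.
by rewrite !mul1r.
Qed.

Lemma vf_appL X a f g :
  vf_app X (csmooth M a * f + g) = csmooth M a * vf_app X f + vf_app X g.
Proof. by apply: smooth_fun_ext => p; exact: tangentL. Qed.

Lemma vf_appM X f g : vf_app X (f * g) = vf_app X f * g + f * vf_app X g.
Proof. by apply: smooth_fun_ext => p; exact: tangentM. Qed.

Fact bracket_tangent X Y p : bracket_at X Y p \in tangent_pred p.
Proof.
apply/asboolP; split=> [a f g|f g]; rewrite /bracket_at.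
  by rewrite !vf_appL !tangentL mulrBr opprD addrACA.
rewrite !vf_appM !tangentD !tangentM /=.
ring.
Qed.

Fact bracket_smooth X Y f : smooth (fun p => Tangent (bracket_tangent X Y p) f).
Proof.
exact: (smoothD (vf_smooth X (vf_app Y f)) (smoothN (vf_smooth Y (vf_app X f)))).
Qed.

Definition bracket X Y := VectorField (bracket_smooth X Y).

End VectorFields.

Section Metrics.
Variables (R : realType) (m : nat) (M : manifold R m).
Local Notation VF := (vector_field M).
Local Notation Cinf := (smooth_fun M).

Definition is_basis_at n (p : M) (E : 'I_n -> VF) :=
  forall v : tangent p, exists! c : 'rV[R]_n, v = \sum_i c 0 i *: E i p.

(* Signature (r, s) means r plus signs and s minus signs. *)
Definition has_signature (g : VF -> VF -> Cinf) (r s : nat) :=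
  forall p, exists2 E : 'I_(r + s) -> VF, is_basis_at p E &
    forall i j : 'I_(r + s),
      g (E i) (E j) p = if i == j then if (i < r)%N then 1 else -1 else 0.

(* Tensor fields are C^oo(M)-multilinear maps on vector fields.  The form g_p on
   T_pM is given by g_p (X p) (Y p) = g X Y p; every tangent vector at p is the
   value at p of some vector field, so quantifying over X p with X : VF is
   quantifying over T_pM. *)
Record metric := Metric {
  metric_val :> VF -> VF -> Cinf;
  metric_linear : forall f X Y Z,
    metric_val (f *: X + Y) Z = f * metric_val X Z + metric_val Y Z;
  metric_sym : forall X Y, metric_val X Y = metric_val Y X;
  metric_nondegenerate : forall p X,
    (forall Y, metric_val X Y p = 0) -> X p = 0;
  metric_constant_index :
    exists r s, (r + s = m)%N /\ has_signature metric_val r s }.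

Definition riemannian (g : metric) :=
  forall p (X : VF), X p != 0 -> 0 < g X X p.

(* [A] is the matrix of J_p in the basis (E i p)_i of T_pM. *)
Definition trace_vanishes (J : {linear VF -> VF}) :=
  forall p (E : 'I_m -> VF) (A : 'M[R]_m), is_basis_at p E ->
    (forall i, J (E i) p = \sum_j A i j *: E j p) -> \tr A = 0.

Record alpha_eps_structure (alpha eps : R) (J : {linear VF -> VF}) (g : metric) :
    Prop := AlphaEpsStructure {
  struct_sqr : forall X, J (J X) = csmooth M alpha *: X;
  struct_metric : forall X Y, g (J X) (J Y) = csmooth M eps * g X Y;
  struct_riemannian : eps = 1 -> riemannian g;
  struct_neutral : eps = -1 -> exists2 n, m = n.*2 & has_signature g n n;
  struct_trace : alpha = 1 -> eps = 1 -> trace_vanishes J }.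

End Metrics.

Section Connections.
Variables (R : realType) (m : nat) (M : manifold R m).
Local Notation VF := (vector_field M).
Local Notation Cinf := (smooth_fun M).

Record connection := Connection {
  conn_val :> VF -> VF -> VF;
  conn_linear : forall (f : Cinf) X Y Z,
    conn_val (f *: X + Y) Z = f *: conn_val X Z + conn_val Y Z;
  conn_additive : forall X Y Z, conn_val X (Y + Z) = conn_val X Y + conn_val X Z;
  conn_leibniz : forall (f : Cinf) X Y,
    conn_val X (f *: Y) = vf_app X f *: Y + f *: conn_val X Y }.

Definition torsion (D : connection) X Y := D X Y - D Y X - bracket X Y.

Definition levi_civita (g : metric M) (D : connection) :=
  (forall X Y, torsion D X Y = 0) /\
  (forall X Y Z, vf_app X (g Y Z) = g (D X Y) Z + g Y (D X Z)).

(* The covariant derivative of a (1,1)-tensor field: (nabla_X J) Y. *)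
Definition nablaJ (D : connection) (J : {linear VF -> VF}) X Y :=
  D X (J Y) - J (D X Y).

Lemma nablaJ_linearl D J f X Y Z :
  nablaJ D J (f *: X + Y) Z = f *: nablaJ D J X Z + nablaJ D J Y Z.
Proof.
by rewrite /nablaJ !conn_linear linearD linearZ scalerBr opprD addrACA.
Qed.

Lemma nablaJ_additive D J X Y Z :
  nablaJ D J X (Y + Z) = nablaJ D J X Y + nablaJ D J X Z.
Proof. by rewrite /nablaJ linearD !conn_additive linearD opprD addrACA. Qed.

Lemma nablaJ_scale D J f X Y : nablaJ D J X (f *: Y) = f *: nablaJ D J X Y.
Proof.
rewrite /nablaJ conn_leibniz linearD !linearZ /= conn_leibniz scalerBr.
by rewrite opprD addrACA subrr add0r.
Qed.

(* The first canonical connection; [D] is meant to be the Levi-Civita connection. *)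
Definition canonical_val (alpha : R) J (D : connection) X Y :=
  D X Y + csmooth M (- alpha / 2%:R) *: nablaJ D J X (J Y).

Fact canonical_linear alpha J D f X Y Z :
  canonical_val alpha J D (f *: X + Y) Z =
  f *: canonical_val alpha J D X Z + canonical_val alpha J D Y Z.
Proof.
rewrite /canonical_val conn_linear nablaJ_linearl !scalerDr !scalerA.
by rewrite [_ * f]mulrC addrACA.
Qed.

Fact canonical_additive alpha J D X Y Z :
  canonical_val alpha J D X (Y + Z) =
  canonical_val alpha J D X Y + canonical_val alpha J D X Z.
Proof.
by rewrite /canonical_val conn_additive (linearD J) nablaJ_additive scalerDr addrACA.
Qed.

Fact canonical_leibniz alpha J D f X Y :
  canonical_val alpha J D X (f *: Y) =
  vf_app X f *: Y + f *: canonical_val alpha J D X Y.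
Proof.
rewrite /canonical_val conn_leibniz (linearZZ J) nablaJ_scale.
by rewrite (scalerDr f (D X Y)) !scalerA [_ * f]mulrC addrA.
Qed.

Definition first_canonical alpha J D : connection :=
  Connection (canonical_linear alpha J D) (canonical_additive alpha J D)
             (canonical_leibniz alpha J D).

Definition kaehler_type (D : connection) J := forall X Y, nablaJ D J X Y = 0.

Definition nijenhuis (J : {linear VF -> VF}) X Y :=
  J (J (bracket X Y)) + bracket (J X) (J Y)
  - J (bracket (J X) Y) - J (bracket X (J Y)).

Definition integrable J := forall X Y, nijenhuis J X Y = 0.

End Connections.

(* Main.v *)
Require Import Defs.
From HB Require Import structures.
From mathcomp Require Import all_boot all_order all_algebra.
From mathcomp Require Import all_classical reals topology normedtype derive.
From mathcomp Require Import ring lra.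

(** Write P(X,Y) for the covariant derivative (D_X J)Y.  Since the Levi-Civita
    connection D is torsion free, the torsion of the first canonical connection
    only sees P:  T0(X,Y) = -(alpha/2) (P(X,JY) - P(Y,JX))
    ([torsion_first_canonical]).

    Kaehler type.  Put S(X,Y) = P(X,JY).  If T0 = 0 then S is symmetric.
    Differentiating g(JY,JZ) = eps g(Y,Z) makes the form g(S(X,Y),Z) skew in
    Y and Z ([metric_nablaJ_skew]).  A trilinear form symmetric in its first two
    arguments and skew in its last two vanishes ([sym_skew_eq0]), so S = 0 by
    nondegeneracy of g, and hence P = 0 because J is invertible.

    Integrability.  Expressing brackets through D turns the Nijenhuis tensor into
    P(JX,Y) - P(JY,X) + P(X,JY) - P(Y,JX) ([nijenhuis_nablaJ]).  Substituting
    J^2 = alpha in the formula for T0 gives, up to a nonzero constant, the same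
    expression:  T0(JX,JY) + alpha T0(X,Y) = -(1/2) N_J(X,Y)
    ([torsion_nijenhuis]). *)

Set Implicit Arguments.
Unset Strict Implicit.
Unset Printing Implicit Defensive.

Import Order.TTheory GRing.Theory Num.Theory.
Local Open Scope ring_scope.

(** The two symmetries pull apart: going once around the three arguments by
    alternating them returns to the starting value with the opposite sign. *)
Lemma sym_skew_eq0 (T : Type) (R : realDomainType) (A : T -> T -> T -> R) :
    (forall x y z, A x y z = A y x z) -> (forall x y z, A x y z = - A x z y) ->
  forall x y z, A x y z = 0.
Proof.
move=> sym skew x y z; have : A x y z = - A x y z; last by lra.
by rewrite {1}skew sym skew sym skew sym opprK.
Qed.

Section Calculus.
Variables (R : realType) (m : nat) (M : manifold R m).
Implicit Types (X Y Z : vector_field M) (f : smooth_fun M) (g : metric M).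

Lemma csmoothM (a b : R) : csmooth M a * csmooth M b = csmooth M (a * b).
Proof. exact: smooth_fun_ext. Qed.

Lemma csmooth1 : csmooth M 1 = 1.
Proof. exact: smooth_fun_ext. Qed.

Lemma scale_csmooth_eq0 (a : R) X : a != 0 -> csmooth M a *: X = 0 -> X = 0.
Proof.
move=> a0 /(congr1 (fun Y => csmooth M a^-1 *: Y)).
by rewrite scalerA csmoothM mulVf // csmooth1 scale1r scaler0.
Qed.

Lemma vf_app_csmooth X (a : R) f :
  vf_app X (csmooth M a * f) = csmooth M a * vf_app X f.
Proof.
have X0 : vf_app X 0 = 0.
  have := vf_appL X 1 0 0; rewrite csmooth1 !mul1r addr0 => /esym/eqP.
  by rewrite -subr_eq0 addrK => /eqP.
by have := vf_appL X a f 0; rewrite X0 !addr0.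
Qed.

Lemma metricDl g X Y Z : g (X + Y) Z = g X Z + g Y Z.
Proof. by have := metric_linear g 1 X Y Z; rewrite scale1r mul1r. Qed.

Lemma metric0l g Z : g 0 Z = 0.
Proof. by apply: (addrI (g 0 Z)); rewrite -metricDl !addr0. Qed.

Lemma metricZl g f X Z : g (f *: X) Z = f * g X Z.
Proof. by have := metric_linear g f X 0 Z; rewrite metric0l !addr0. Qed.

Lemma metricDr g X Y Z : g X (Y + Z) = g X Y + g X Z.
Proof. by rewrite !(Defs.metric_sym g X) metricDl. Qed.

Lemma metricZr g f X Z : g X (f *: Z) = f * g X Z.
Proof. by rewrite !(Defs.metric_sym g X) metricZl. Qed.

Lemma metric_eq0 g X : (forall Y p, g X Y p = 0) -> X = 0.
Proof.
by move=> gX0; apply: vf_ext => p f; rewrite (@metric_nondegenerate _ _ _ g).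
Qed.

Lemma bracket_torsion_free (D : connection M) X Y :
  torsion D X Y = 0 -> bracket X Y = D X Y - D Y X.
Proof. by move/eqP; rewrite subr_eq0 => /eqP. Qed.

End Calculus.

Section CanonicalTorsion.
Variables (R : realType) (m : nat) (M : manifold R m).
Variables (J : {linear vector_field M -> vector_field M}) (D : connection M).
Implicit Types (X Y Z : vector_field M).
Hypothesis torsion_free : forall X Y, torsion D X Y = 0.

Local Notation P := (nablaJ D J).

Lemma conn_endo X Y : D X (J Y) = P X Y + J (D X Y).
Proof. by rewrite /nablaJ subrK. Qed.

Lemma torsion_first_canonical (alpha : R) X Y :
  torsion (first_canonical alpha J D) X Y =
  csmooth M (- alpha / 2%:R) *: (P X (J Y) - P Y (J X)).
Proof.
(* Adding the zero torsion of D to the right makes the bracket cancel. *)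
rewrite -[RHS]add0r -(torsion_free X Y) scalerBr /torsion /= /canonical_val.
apply: vf_ext => p f.
(* Applied to a function at a point, the identity becomes one between reals. *)
set U := _ *: P X _; set V := _ *: P Y _.
change (D X Y p f + U p f - (D Y X p f + V p f) - bracket X Y p f =
  D X Y p f - D Y X p f - bracket X Y p f + (U p f - V p f)).
ring.
Qed.

Variable alpha : R.
Hypothesis alpha_sqr : alpha * alpha = 1.
Hypothesis J_sqr : forall X, J (J X) = csmooth M alpha *: X.

Lemma endo_inj0 X : J X = 0 -> X = 0.
Proof.
move=> JX0; have := J_sqr X; rewrite JX0 linear0 => /esym.
apply: scale_csmooth_eq0; apply/eqP => a0.
by move: alpha_sqr; rewrite a0 mul0r => /eqP; rewrite eq_sym oner_eq0.
Qed.

(** Covariant derivative of the constant tensor J^2 = alpha Id. *)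
Lemma nablaJ_endo X Y : P X (J Y) = - J (P X Y).
Proof.
have cst Z : D X (csmooth M alpha *: Z) = csmooth M alpha *: D X Z.
  rewrite conn_leibniz (_ : vf_app _ _ = 0) ?scale0r ?add0r //.
  have := vf_app_csmooth X alpha 1; rewrite mulr1 => ->.
  suff -> : vf_app X 1 = 0 by rewrite mulr0.
  have := vf_appM X 1 1; rewrite !mulr1 mul1r => /esym/eqP.
  by rewrite -subr_eq0 addrK => /eqP.
by rewrite /nablaJ J_sqr cst linearB /= J_sqr opprB.
Qed.

(** In each bracket, D_X(JY) = P(X,Y) + J D_X Y; the terms with J applied to D
    cancel in the Nijenhuis combination, which is why that combination is a
    tensor. *)
Lemma nijenhuis_nablaJ X Y :
  nijenhuis J X Y = P (J X) Y - P (J Y) X + (P X (J Y) - P Y (J X)).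
Proof.
rewrite /nijenhuis !(bracket_torsion_free (torsion_free _ _)) !conn_endo.
rewrite !nablaJ_endo.
move: (P (J X) Y) (P (J Y) X) (P X Y) (P Y X) => a b c' d'.
rewrite !(linearB, linearD) /=; apply: vf_ext => p f.
set c := J c'; set d := J d'.
set u := J (D (J X) Y); set v := J (D (J Y) X).
set s := J (J (D X Y)); set t := J (J (D Y X)).
change (s p f - t p f + (a p f + u p f + (- b p f - v p f))
  + (- u p f + (- - d p f - - t p f)) + (- c p f - s p f - - v p f)
  = a p f - b p f + (- c p f - - d p f)).
ring.
Qed.

Lemma torsion_nijenhuis X Y :
  let T0 := torsion (first_canonical alpha J D) in
  T0 (J X) (J Y) + csmooth M alpha *: T0 X Y =
  csmooth M (- 2%:R^-1) *: nijenhuis J X Y.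
Proof.
rewrite /= !torsion_first_canonical !J_sqr !nablaJ_scale -scalerBr !scalerA.
rewrite [csmooth M alpha * _]mulrC -scalerDr -nijenhuis_nablaJ csmoothM.
by rewrite mulrAC mulNr alpha_sqr mulN1r.
Qed.

Variables (g : metric M) (eps : R).
Hypothesis g_J : forall X Y, g (J X) (J Y) = csmooth M eps * g X Y.
Hypothesis g_parallel :
  forall X Y Z, vf_app X (g Y Z) = g (D X Y) Z + g Y (D X Z).

(** Covariant derivative of the compatibility g(JY,JZ) = eps g(Y,Z). *)
Lemma metric_nablaJ X Y Z : g (P X Y) (J Z) = - g (J Y) (P X Z).
Proof.
have := g_parallel X (J Y) (J Z).
rewrite g_J vf_app_csmooth g_parallel mulrDr -!g_J !conn_endo.
rewrite metricDl metricDr => e; apply/eqP; rewrite -addr_eq0.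
(* The terms where J stands outside D occur on both sides of e. *)
rewrite -[_ + _ == 0](inj_eq (addrI (g (J (D X Y)) (J Z) + g (J Y) (J (D X Z))))).
rewrite addr0 [X in _ == X]e; apply/eqP; ring.
Qed.

(** [metric_nablaJ] at JY, with Z = alpha J (J Z): the two factors alpha
    coming from J^2 cancel, so the sign does not depend on alpha or eps. *)
Lemma metric_nablaJ_skew X Y Z : g (P X (J Y)) Z = - g (P X (J Z)) Y.
Proof.
have Jinv W : W = csmooth M alpha *: J (J W).
  by rewrite J_sqr scalerA csmoothM alpha_sqr csmooth1 scale1r.
rewrite {1}(Jinv Z) metricZr metric_nablaJ J_sqr metricZl mulrN mulrA.
by rewrite csmoothM alpha_sqr csmooth1 mul1r Defs.metric_sym.
Qed.

Lemma nablaJ_eq0_of_sym :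
  (forall X Y, P X (J Y) = P Y (J X)) -> forall X Y, P X Y = 0.
Proof.
move=> Psym X Y; apply: endo_inj0; apply/eqP; rewrite -oppr_eq0 -nablaJ_endo.
apply/eqP/(metric_eq0 (g := g)) => Z p.
apply: (sym_skew_eq0 (A := fun X Y Z => g (P X (J Y)) Z p)) => {X Y Z} X Y Z.
  by rewrite Psym.
by rewrite metric_nablaJ_skew.
Qed.

End CanonicalTorsion.

Theorem theorem3p1 (R : realType) (m : nat) (M : manifold R m) (alpha eps : R)
    (halpha : alpha = 1 \/ alpha = -1) (heps : eps = 1 \/ eps = -1)
    (J : {linear vector_field M -> vector_field M}) (g : metric M)
    (hJg : alpha_eps_structure alpha eps J g)
    (D : connection M) (hD : levi_civita g D) :
  let T0 := torsion (first_canonical alpha J D) in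
  (kaehler_type D J <-> (forall X Y, T0 X Y = 0)) /\
  (integrable J <->
     (forall X Y, T0 (J X) (J Y) + csmooth M alpha *: T0 X Y = 0)).
Proof.
have [tf gpar] := hD; have Jsqr := struct_sqr hJg.
have asqr : alpha * alpha = 1.
  by case: halpha => ->; rewrite ?mulrNN mul1r.
move=> T0; split; split.
- by move=> K X Y; rewrite /T0 torsion_first_canonical // !K subrr scaler0.
- move=> T00; apply: (nablaJ_eq0_of_sym asqr Jsqr (struct_metric hJg) gpar).
  move=> X Y; apply/eqP; rewrite -subr_eq0; apply/eqP.
  have := T00 X Y; rewrite /T0 torsion_first_canonical //.
  apply: scale_csmooth_eq0; case: halpha => ->; lra.
- by move=> N0 X Y; rewrite /T0 torsion_nijenhuis // N0 scaler0.
- move=> T0J X Y; have := T0J X Y; rewrite /T0 torsion_nijenhuis //.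
  by apply: scale_csmooth_eq0; lra.
Qed.
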